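(* Let $S$ and $T$ be semigroups, let $A$ be an $(S,T)$-biact, and let $\rho$ be a congruence on $A$. For each $K\in\{L,R,J\}$, if $A$ satisfies $M_K$ then so does the quotient biact $A/\rho$.
   Context: For a semigroup $S$, $S^1$ denotes the monoid obtained from $S$ by adjoining a new identity $1$, which acts as the identity on any biact. An $(S,T)$-biact is a set $A$ with maps $S\times A\to A$, $(s,a)\mapsto sa$, and $A\times T\to A$, $(a,t)\mapsto at$, such that $s(s'a)=(ss')a$, $(at)t'=a(tt')$ and $(sa)t=s(at)$ for all $a\in A$, $s,s'\in S$, $t,t'\in T$. On $A$ define preorders $a\leq_{\mathcal L}b\Leftrightarrow S^1a\subseteq S^1b$, $a\leq_{\mathcal R}b\Leftrightarrow aT^1\subseteq bT^1$, $a\leq_{\mathcal J}b\Leftrightarrow S^1aT^1\subseteq S^1bT^1$. Each induces an equivalence relation ($\mathcal L$, $\mathcal R$, $\mathcal J$ respectively: $a\,\mathcal K\,b$ iff $a\leq_{\mathcal K}b$ and $b\leq_{\mathcal K}a$) and a partial order on the set of its classes. The biact $A$ satisfies $M_L$ (resp. $M_R$, $M_J$) if every non-empty set of $\mathcal L$-classes (resp. $\mathcal R$-classes, $\mathcal J$-classes) contains a minimal member. A congruence on $A$ is an equivalence relation $\rho$ such that $(a,b)\in\rho$ implies $(sa,sb)\in\rho$ and $(at,bt)\in\rho$ for all $s\in S$, $t\in T$. The quotient $A/\rho$ is the $(S,T)$-biact of $\rho$-classes with actions $s[a]_\rho=[sa]_\rho$ and $[a]_\rho t=[at]_\rho$.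 *)

(* Defs.v *)
From HB Require Import structures.
From mathcomp Require Import all_boot.
From mathcomp Require Import boolp classical_sets.

Set Implicit Arguments.
Unset Strict Implicit.
Unset Printing Implicit Defensive.

Local Open Scope classical_set_scope.

(* The Choice structure contained in [semigroupType] is no restriction: under
   the axioms of [boolp] every type has one.  [semigroupType] allows the empty
   semigroup. *)

(* S^1: [None] is the new identity, adjoined even if S already has one. *)
Definition adjoin_one (S : semigroupType) : Type := option S.

HB.instance Definition _ (S : semigroupType) := Choice.on (adjoin_one S).

Section AdjoinOne.
Variable S : semigroupType.

Definition adjoin_mul (x y : adjoin_one S) : adjoin_one S :=
  match x, y with
  | None, _ => y
  | _, None => x
  | Some s, Some s' => Some (s * s')%g
  end.

Lemma adjoin_mulA : associative adjoin_mul.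
Proof. by move=> [x|] [y|] [z|] //=; rewrite mulgA. Qed.

Lemma adjoin_mul1g : left_id None adjoin_mul.
Proof. by []. Qed.

Lemma adjoin_mulg1 : right_id None adjoin_mul.
Proof. by case. Qed.

HB.instance Definition _ := isMonoid.Build (adjoin_one S)
  adjoin_mulA adjoin_mul1g adjoin_mulg1.

End AdjoinOne.

Record biact (S T : semigroupType) := Biact {
  carrier :> Type;
  lact : S -> carrier -> carrier;
  ract : carrier -> T -> carrier;
  lactM : forall s s' a, lact s (lact s' a) = lact (s * s')%g a;
  ractM : forall a t t', ract (ract a t) t' = ract a (t * t')%g;
  lractA : forall s a t, ract (lact s a) t = lact s (ract a t) }.

Section AdjoinedAction.
Variables (S T : semigroupType) (A : biact S T).

Definition lact1 (s : adjoin_one S) (a : A) : A :=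
  if s is Some s' then lact s' a else a.

Definition ract1 (a : A) (t : adjoin_one T) : A :=
  if t is Some t' then ract a t' else a.

Lemma lact1M s s' a : lact1 s (lact1 s' a) = lact1 (s * s')%g a.
Proof. by case: s s' => [s|] [s'|] //=; rewrite lactM. Qed.

Lemma ract1M a t t' : ract1 (ract1 a t) t' = ract1 a (t * t')%g.
Proof. by case: t t' => [t|] [t'|] //=; rewrite ractM. Qed.

Lemma lract1A s a t : ract1 (lact1 s a) t = lact1 s (ract1 a t).
Proof. by case: s t => [s|] [t|] //=; rewrite lractA. Qed.

End AdjoinedAction.

Section Classes.
Variables (X : Type) (r : X -> X -> Prop).

Definition class_of (x : X) : set X := [set y | r x y].

Definition classes : Type := set_type (range class_of).

Definition to_class (x : X) : classes :=
  exist _ (class_of x) (mem_set (imageT class_of x)).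

Definition class_repr (C : classes) : X := sval (cid2 (set_mem (valP C))).

Lemma class_reprK (C : classes) : to_class (class_repr C) = C.
Proof.
by apply: val_inj => /=; rewrite /class_repr; case: cid2.
Qed.

End Classes.

Inductive green := GreenL | GreenR | GreenJ.

Section Green.
Variables (S T : semigroupType) (A : biact S T) (K : green).

(* S^1 a, a T^1 or S^1 a T^1 *)
Definition principal (a : A) : set A :=
  match K with
  | GreenL => [set lact1 s a | s in [set: adjoin_one S]]
  | GreenR => [set ract1 a t | t in [set: adjoin_one T]]
  | GreenJ => [set ract1 (lact1 s a) t | s in [set: adjoin_one S]
                                       & t in [set: adjoin_one T]]
  end.

Definition green_le (a b : A) : Prop := principal a `<=` principal b.

Definition green_eq (a b : A) : Prop := green_le a b /\ green_le b a.

(* [exists] and [forall] representatives are equivalent here. *)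
Definition green_class_le (X Y : classes green_eq) : Prop :=
  exists a b, [/\ val X a, val Y b & green_le a b].

Definition min_cond : Prop :=
  forall F : set (classes green_eq), F !=set0 ->
    exists2 X, F X & forall Y, F Y -> green_class_le Y X -> Y = X.

End Green.

Arguments min_cond {S T} A K.

Record congruence (S T : semigroupType) (A : biact S T) := Congruence {
  cong_rel :> A -> A -> Prop;
  cong_refl : forall a, cong_rel a a;
  cong_sym : forall a b, cong_rel a b -> cong_rel b a;
  cong_trans : forall a b c, cong_rel a b -> cong_rel b c -> cong_rel a c;
  cong_lact : forall s a b, cong_rel a b -> cong_rel (lact s a) (lact s b);
  cong_ract : forall a b t, cong_rel a b -> cong_rel (ract a t) (ract b t) }.

Section Quotient.
Variables (S T : semigroupType) (A : biact S T) (rho : congruence A).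

Let pi : A -> classes rho := to_class rho.

Lemma to_class_eq a b : rho a b -> pi a = pi b.
Proof.
move=> ab; apply: val_inj; rewrite /= /class_of; apply/seteqP; split=> c /=.
  by apply: cong_trans; apply: cong_sym.
exact: cong_trans.
Qed.

Lemma class_repr_rel a : rho (class_repr (pi a)) a.
Proof.
have /(congr1 val)/= e := class_reprK (pi a).
suff: class_of rho (class_repr (pi a)) a by [].
by rewrite e; apply: cong_refl.
Qed.

Definition quot_lact (s : S) (C : classes rho) : classes rho :=
  pi (lact s (class_repr C)).

Definition quot_ract (C : classes rho) (t : T) : classes rho :=
  pi (ract (class_repr C) t).

(* s [a] = [s a] and [a] t = [a t] *)
Lemma quot_lactE s a : quot_lact s (pi a) = pi (lact s a).
Proof. by apply/to_class_eq/cong_lact/class_repr_rel. Qed.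

Lemma quot_ractE a t : quot_ract (pi a) t = pi (ract a t).
Proof. by apply/to_class_eq/cong_ract/class_repr_rel. Qed.

Lemma quot_lactM s s' C : quot_lact s (quot_lact s' C) = quot_lact (s * s')%g C.
Proof. by rewrite quot_lactE lactM. Qed.

Lemma quot_ractM C t t' : quot_ract (quot_ract C t) t' = quot_ract C (t * t')%g.
Proof. by rewrite quot_ractE ractM. Qed.

Lemma quot_lractA s C t : quot_ract (quot_lact s C) t = quot_lact s (quot_ract C t).
Proof. by rewrite quot_lactE quot_ractE lractA. Qed.

Definition quotient : biact S T := Biact quot_lactM quot_ractM quot_lractA.

End Quotient.

(* Main.v *)
Require Import Defs.
From mathcomp Require Import all_boot.
From mathcomp Require Import boolp classical_sets.

(** Both conditions say that every non-empty set of elements has an element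
    that is minimal for the preorder.  Given a non-empty subset [P] of the
    quotient, take a minimal element [a] of its preimage: anything below [[a]]
    in [P] has the form [s[a]t = [sat]] with [sat <= a] in the preimage, so
    [a <= sat] and hence [[a] <= [sat]]. *)

Set Implicit Arguments.
Unset Strict Implicit.
Unset Printing Implicit Defensive.

Local Open Scope classical_set_scope.

Section GreenPreorder.
Variables (S T : semigroupType) (A : biact S T) (K : green).
Implicit Types a b c : A.

Lemma principal_refl a : principal K a a.
Proof.
by case: K => /=; [exists None|exists None|exists None => //; exists None].
Qed.

(** [principal K b] contains [b] and is closed under the one- or two-sided action that defines it,
    so it contains all of [principal K a] as soon as it contains [a]. *)
Lemma green_leP a b : green_le K a b <-> principal K b a.
Proof.
split=> [ab|]; first exact/ab/principal_refl.
rewrite /green_le; case: K => /=.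
- move=> [s _ <-] _ [s' _ <-].
  by exists (s' * s)%g => //; rewrite lact1M.
- move=> [t _ <-] _ [t' _ <-].
  by exists (t * t')%g => //; rewrite ract1M.
- move=> [s _ [t _ <-]] _ [s' _ [t' _ <-]].
  exists (s' * s)%g => //; exists (t * t')%g => //.
  by rewrite -lact1M -ract1M -[in RHS]lract1A.
Qed.

Lemma green_le_trans b a c : green_le K a b -> green_le K b c -> green_le K a c.
Proof. exact: subset_trans. Qed.

Lemma green_eq_refl a : green_eq K a a.
Proof. by split=> c. Qed.

Lemma to_green_class_eq a b :
  to_class (green_eq K) a = to_class (green_eq K) b <-> green_eq K a b.
Proof.
split=> [/(congr1 val)/= e|[ab ba]].
  suff: class_of (green_eq K) a b by [].
  by rewrite e; apply: green_eq_refl.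
apply: val_inj; apply/seteqP; split=> c [] /=.
  by move=> ac ca; split; [apply: green_le_trans ba ac|apply: green_le_trans ca ab].
by move=> bc cb; split; [apply: green_le_trans ab bc|apply: green_le_trans cb ba].
Qed.

Lemma green_class_leE a b :
  green_class_le (to_class (green_eq K) a) (to_class (green_eq K) b) <->
  green_le K a b.
Proof.
split=> [[a' [b' [[aa' _] [_ b'b] a'b']]]|ab]; last first.
  by exists a, b; split=> //; apply: green_eq_refl.
exact: green_le_trans (green_le_trans aa' a'b') b'b.
Qed.

(** Removes classes from the argument: sets of classes and sets of elements correspond by image and
    preimage under [to_class]. [P] need not be a union of classes. *)
Lemma min_condP :
  min_cond A K <->
  forall P : set A, P !=set0 ->
    exists2 a, P a & forall b, P b -> green_le K b a -> green_le K a b.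
Proof.
split=> [minA P [a0 Pa0]|minA F [X0 FX0]].
  have [|_ [a Pa <-] mina] := minA (to_class (green_eq K) @` P).
    by exists (to_class (green_eq K) a0); exists a0.
  exists a => // b Pb /green_class_leE ba.
  (* Minimality makes the classes of [b] and [a] equal; the second half of [green_eq K b a] is the
     goal. *)
  by have /to_green_class_eq[] := mina _ (ex_intro2 _ _ b Pb erefl) ba.
have [|a Fa mina] := minA [set a | F (to_class (green_eq K) a)].
  by exists (class_repr X0); rewrite /= class_reprK.
exists (to_class (green_eq K) a) => // Y; rewrite -(class_reprK Y).
move=> FY /green_class_leE Ya; apply/to_green_class_eq; split=> //.
exact: mina.
Qed.

End GreenPreorder.

Section QuotientPrincipal.
Variables (S T : semigroupType) (A : biact S T) (rho : congruence A).

Let pi (a : A) : quotient rho := to_class rho a.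

Lemma quot_lact1E s a : lact1 s (pi a) = pi (lact1 s a).
Proof. by case: s => [s|] //=; apply: quot_lactE. Qed.

Lemma quot_ract1E a t : ract1 (pi a) t = pi (ract1 a t).
Proof. by case: t => [t|] //=; apply: quot_ractE. Qed.

(** The projection commutes with the actions of the adjoined monoids. The inclusion from left to
    right is what lifts elements below [pi a] back to [A]. *)
Lemma principal_quotient K a : principal K (pi a) = pi @` principal K a.
Proof.
apply/seteqP; split=> q; case: K => /=.
- by move=> [s _ <-]; rewrite quot_lact1E; do 2!eexists.
- by move=> [t _ <-]; rewrite quot_ract1E; do 2!eexists.
- move=> [s _ [t _ <-]]; rewrite quot_lact1E quot_ract1E.
  by exists (ract1 (lact1 s a) t) => //; exists s => //; exists t.
- by move=> [_ [s _ <-] <-]; exists s; rewrite ?quot_lact1E.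
- by move=> [_ [t _ <-] <-]; exists t; rewrite ?quot_ract1E.
- move=> [_ [s _ [t _ <-]] <-]; exists s => //; exists t => //.
  by rewrite quot_lact1E quot_ract1E.
Qed.

Lemma green_le_quotient K a b : green_le K a b -> green_le K (pi a) (pi b).
Proof. by rewrite /green_le !principal_quotient; apply: image_subset. Qed.

End QuotientPrincipal.

Theorem proposition4p1 :
  forall (S T : semigroupType) (A : biact S T) (rho : congruence A) (K : green),
    min_cond A K -> min_cond (quotient rho) K.
Proof.
move=> S T A rho K /min_condP minA; apply/min_condP => P [q Pq].
have [|a Pa mina] := minA [set a | P (to_class rho a)].
  by exists (class_repr q); rewrite /= class_reprK.
exists (to_class rho a) => // p Pp /green_leP.
(* The representative [b] of [p] is taken inside [principal K a]: an arbitrary one need not lie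
   below [a]. *)
rewrite principal_quotient => -[b ab bp].
rewrite -bp in Pp *; apply: green_le_quotient.
by apply: mina => //; apply/green_leP.
Qed.
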